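(* For $1\le\ell\le n$ define $$A_\ell=\frac1d C_1^{(\ell)}+\cdots+\frac1d C_d^{(\ell)}.$$ Then the Cesàro limit $\lim_{N\to\infty}\frac1N\sum_{m=1}^NA_\ell^{\,m}$ exists and equals $$\Omega_\ell=\langle K^{(\ell)}\rangle=\sum_{k\in\mathcal K}\lambda(k)\,k^{(\ell)},$$ the average taken over the kernel $\mathcal K$ of the semigroup $\mathcal S$ generated by $\{C_1,\ldots,C_d\}$.
   Context: The setting: a directed graph on the vertex set $\{1,\ldots,n\}$ in which each vertex has out-degree $d$, with adjacency matrix $\mathcal A$ such that $A=d^{-1}\mathcal A$ is irreducible and aperiodic; $\mathcal A=C_1+\cdots+C_d$, where each $C_i$ is a binary stochastic matrix (a $0$-$1$ matrix with exactly one $1$ in each row). $\mathcal S$ is the (finite) semigroup generated by the $C_i$ under matrix multiplication, and $\mathcal K$ is its kernel, i.e. its minimal ideal, which consists of the elements of $\mathcal S$ of minimal rank. Each binary stochastic matrix $F$ corresponds to the function $f$ on $\{1,\ldots,n\}$ with $F_{ij}=1$ iff $f(i)=j$; $F^{(\ell)}$ is the matrix indexed by the $\ell$-element subsets $I,J$ of $\{1,\ldots,n\}$ with $F^{(\ell)}_{IJ}=1$ if $f(I)=J$ and $0$ otherwise. Let $\mu^{(1)}(w)=\#\{i:C_i=w\}/d$ for $w\in\mathcal S$, let $\mu^{(m)}$ be its $m$-th convolution power on $\mathcal S$, and let $\lambda(w)=\lim_{N\to\infty}\frac1N\sum_{m=1}^N\mu^{(m)}(w)$; it is known that this limit exists and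 that $\lambda$ is a probability measure with support $\mathcal K$. $\langle\cdot\rangle$ denotes averaging over $K\in\mathcal K$ with respect to $\lambda$. *)

(* Defs.v *)
From HB Require Import structures.
From mathcomp Require Import all_boot all_order all_algebra.
From mathcomp Require Import all_classical all_reals all_analysis.

Set Implicit Arguments.
Unset Strict Implicit.
Unset Printing Implicit Defensive.

Import Order.TTheory GRing.Theory Num.Theory.
Import numFieldNormedType.Exports.

Local Open Scope classical_set_scope.
Local Open Scope ring_scope.

Definition binary_stochastic (R : realType) (n : nat) (F : 'M[R]_n) : Prop :=
  (forall i j, F i j = 0 \/ F i j = 1) /\ (forall i, exists! j, F i j = 1).

(* [adj i j] is the number of edges from i to j; parallel edges are allowed. *)
Definition out_regular (n d : nat) (adj : 'M[nat]_n) : Prop :=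
  forall i, (\sum_(j < n) adj i j)%N = d.

Definition irreducible_mx (R : realType) (n : nat) (A : 'M[R]_n) : Prop :=
  forall i j, exists2 m, (0 < m)%N & 0 < (A ^+ m) i j.

(* For each i, the gcd of the return times {m >= 1 | (A^m)_ii > 0} is 1. *)
Definition aperiodic_mx (R : realType) (n : nat) (A : 'M[R]_n) : Prop :=
  forall (i : 'I_n) (g : nat),
    (forall m, (0 < m)%N -> 0 < (A ^+ m) i i -> (g %| m)%N) -> g = 1%N.

Definition mul_closed (R : realType) (n : nat) (X : set 'M[R]_n) : Prop :=
  forall u v, X u -> X v -> X (u *m v).

Definition gen_semigroup (R : realType) (n d : nat) (C : 'I_d -> 'M[R]_n) :
  set 'M[R]_n := smallest (@mul_closed R n) (range C).

Definition semigroup_ideal (R : realType) (n : nat) (S I : set 'M[R]_n) : Prop :=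
  [/\ I !=set0, I `<=` S
    & forall s x, S s -> I x -> I (s *m x) /\ I (x *m s)].

(* The least (nonempty, two-sided) ideal; it exists when S is finite and
   nonempty. *)
Definition semigroup_kernel (R : realType) (n : nat) (S : set 'M[R]_n) :
  set 'M[R]_n := smallest (semigroup_ideal S) set0.

Definition color_kernel (R : realType) (n d : nat) (C : 'I_d -> 'M[R]_n) :
  set 'M[R]_n := semigroup_kernel (gen_semigroup C).

Definition convolution (R : realType) (n : nat) (S : set 'M[R]_n)
    (f g : 'M[R]_n -> R) (w : 'M[R]_n) : R :=
  \sum_(p \in [set p : 'M[R]_n * 'M[R]_n |
                 [/\ S p.1, S p.2 & p.1 *m p.2 = w]]) f p.1 * g p.2.

Definition color_mu1 (R : realType) (n d : nat) (C : 'I_d -> 'M[R]_n)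
    (w : 'M[R]_n) : R :=
  #|[set i : 'I_d | C i == w]%SET|%:R / d%:R.

(* Meaningful for m >= 1 only: S need not have a unit. *)
Definition color_mu (R : realType) (n d : nat) (C : 'I_d -> 'M[R]_n)
    (m : nat) : 'M[R]_n -> R :=
  iter m.-1 (fun f => convolution (gen_semigroup C) f (color_mu1 C))
    (color_mu1 C).

Definition color_lambda (R : realType) (n d : nat) (C : 'I_d -> 'M[R]_n)
    (w : 'M[R]_n) : R :=
  limn (fun N : nat => N%:R^-1 * \sum_(1 <= m < N.+1) color_mu C m w).

(* The function f with F i (f i) = 1; the default is never used when F is
   binary stochastic. *)
Definition fun_of_binmx (R : realType) (n : nat) (F : 'M[R]_n) (i : 'I_n) :
  'I_n := odflt i [pick j | F i j == 1].

Definition lsubset (n l : nat) : finType := {I : {set 'I_n} | #|I| == l}.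

(* Rows and columns are indexed by the l-subsets through [enum_val]. *)
Definition subset_mx (R : realType) (n l : nat) (F : 'M[R]_n) :
  'M[R]_#|lsubset n l| :=
  \matrix_(a < #|lsubset n l|, b < #|lsubset n l|)
    (fun_of_binmx F @: val (enum_val a) == val (enum_val b))%SET%:R.

Definition color_level (R : realType) (n d : nat) (C : 'I_d -> 'M[R]_n)
    (l : nat) : 'M[R]_#|lsubset n l| :=
  \sum_(i < d) d%:R^-1 *: subset_mx l (C i).

Definition color_Omega (R : realType) (n d : nat) (C : 'I_d -> 'M[R]_n)
    (l : nat) : 'M[R]_#|lsubset n l| :=
  \sum_(k \in color_kernel C) color_lambda C k *: subset_mx l k.

(* Main.v *)
Require Import Defs.
From HB Require Import structures.
From mathcomp Require Import all_boot all_order all_algebra.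
From mathcomp Require Import all_classical all_reals all_analysis.

Set Implicit Arguments.
Unset Strict Implicit.
Unset Printing Implicit Defensive.

Import Order.TTheory GRing.Theory Num.Theory.
Import numFieldNormedType.Exports.

Local Open Scope classical_set_scope.
Local Open Scope ring_scope.

(** Multiplying on the right by a uniformly random color is a random walk on
    binary stochastic matrices.  Encoding such matrices by functions, of which
    there are finitely many, turns the walk into a single stochastic matrix
    [walk_mx], and both sides of the theorem are read off the row of its powers
    indexed by the identity.  That row of the m-th power is the convolution
    power of order m ([color_muE]).  Since taking l-subset matrices is
    multiplicative on binary stochastic matrices ([subset_mxM]), it is also the
    family of coefficients of the m-th power of the level-l average over the
    matrices of the walk ([color_level_exp]).

    So everything reduces to the Cesaro means of the powers of [walk_mx].  They
    converge by the mean ergodic theorem for a matrix A with bounded powers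
    ([mean_ergodic]): the space is the direct sum of the fixed vectors of A and
    the range of 1 - A; the means fix the former and are O(1/N) on the latter.

    It remains to see that the limit, which computes lambda, vanishes off the
    kernel ([limit_kernel]).  The kernel is the intersection of all ideals I, so
    a matrix off the kernel misses some I.  The walk cannot leave I, and
    it reaches I from every element s of the semigroup with positive
    probability, since multiplying s by a word representing an element of I
    leads into I.  The limit is invariant under the walk, hence it gives such
    states no mass ([stationary_transient]). *)

(** * The mean ergodic theorem for matrices *)

Section MeanErgodic.
Variable R : realType.

Lemma cvg_mx_coord m n (u : nat -> 'M[R]_(m, n)) (M : 'M[R]_(m, n)) :
  (forall i j, (fun N => u N i j) @ \oo --> M i j) -> u @ \oo --> M.
Proof.
move=> uM A [P MP PA]; rewrite /nbhs/=.
have : \forall N \near \oo, forall i j, P i j (u N i j).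
  by apply: filter_forall => i; apply: filter_forall => j; exact: uM (MP i j).
by apply: filterS => N /PA.
Qed.

Lemma cvg_over_nat (u : nat -> R) (D : R) : (forall N, `|u N| <= D) ->
  (fun N => N%:R^-1 * u N) @ \oo --> 0.
Proof.
move=> uD; rewrite -cvg_shiftS.
apply/norm_cvg0P.
apply: (@squeeze_cvgr _ _ _ _ (cst 0) (fun N => @harmonic R N * D)).
- apply: nearW => N; apply/andP; split; first exact: normr_ge0.
  by rewrite normrM ger0_norm ?invr_ge0// ler_wpM2l ?invr_ge0//.
- exact: cvg_cst.
- rewrite -(mul0r D); apply: cvgMr_tmp; exact: cvg_harmonic.
Qed.

(** The Archimedean property, in the form that kills a real number whose
    multiples by all naturals stay bounded. *)
Lemma natmul_bounded_eq0 (z D : R) : (forall N, N%:R * `|z| <= D) -> z = 0.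
Proof.
move=> zD; apply/eqP/negPn/negP => z0.
have z_gt0 : 0 < `|z| by rewrite normr_gt0.
have D_ge0 : 0 <= D by have := zD 0; rewrite mul0r.
have := archi_boundP (divr_ge0 D_ge0 (ltW z_gt0)).
by rewrite ltr_pdivrMr// ltNge zD.
Qed.

Lemma mulmx_coord_le n (W U : 'M[R]_n) (B : R) :
  (forall i j, `|U i j| <= B) ->
  forall i j, `|(W * U) i j| <= \sum_k `|W i k| * B.
Proof.
move=> UB i j; rewrite mxE; apply: le_trans (ler_norm_sum _ _ _) _.
by apply: ler_sum => k _; rewrite normrM ler_wpM2l.
Qed.

(** Matrices of size 0 form the zero ring, so [scalerAr] does not apply to
    square matrices of arbitrary size; [scalemxAr] does. *)
Lemma scalemx_mulr n (W U : 'M[R]_n) (a : R) : W * (a *: U) = a *: (W * U).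
Proof. by rewrite -[W * _]/(W *m _) -scalemxAr. Qed.

Definition cesaro_mean n (A : 'M[R]_n) (N : nat) : 'M[R]_n :=
  N%:R^-1 *: \sum_(1 <= m < N.+1) A ^+ m.

Lemma cesaro_meanE n (A : 'M[R]_n) N i j :
  cesaro_mean A N i j = N%:R^-1 * \sum_(1 <= m < N.+1) (A ^+ m) i j.
Proof. by rewrite mxE summxE. Qed.

Lemma sum_powers_telescope n (A : 'M[R]_n) N :
  (1 - A) * \sum_(1 <= m < N.+1) A ^+ m = A - A ^+ N.+1.
Proof.
elim: N => [|N IH]; first by rewrite big_geq// mulr0 expr1 subrr.
rewrite big_nat_recr//= mulrDr IH mulrBl mul1r -exprS.
by rewrite addrA subrK.
Qed.

Lemma fixed_mul_exp n (A X : 'M[R]_n) m : X * A = X -> X * A ^+ m = X.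
Proof.
by move=> XA; elim: m => [|m IH]; rewrite ?expr0 ?mulr1// exprS mulrA XA.
Qed.

Section PowerBounded.
Variables (n : nat) (A : 'M[R]_n) (B : R).
Hypothesis A_bd : forall m i j, `|(A ^+ m) i j| <= B.

Lemma powerB_le p q i j : `|(A ^+ p - A ^+ q) i j| <= B + B.
Proof.
rewrite !mxE; apply: le_trans (ler_normB _ _) _.
by rewrite lerD.
Qed.

(** If Z = W (1 - A) is fixed by A, then summing Z A^m = Z over m <= N
    telescopes to N Z = W (A - A^(N+1)), which stays bounded in N. *)
Lemma range_fixed_eq0 (W : 'M[R]_n) : W * (1 - A) * A = W * (1 - A) ->
  W * (1 - A) = 0.
Proof.
set Z := W * (1 - A) => ZA.
have NZ N : N%:R *: Z = W * (A - A ^+ N.+1).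
  rewrite -sum_powers_telescope mulrA -/Z mulr_sumr.
  under eq_bigr do rewrite fixed_mul_exp//.
  by rewrite big_const_nat subSS subn0 iter_addr addr0 scaler_nat.
apply/matrixP => i j; rewrite [RHS]mxE.
apply: (@natmul_bounded_eq0 _ (\sum_k `|W i k| * (B + B))) => N.
have -> : N%:R * `|Z i j| = `|(N%:R *: Z) i j|.
  by move: Z {ZA NZ} => M; rewrite mxE normrM ger0_norm.
rewrite NZ; apply: mulmx_coord_le => k h.
exact: (powerB_le 1).
Qed.

(** By [range_fixed_eq0] the row kernel and the row space of 1 - A meet
    trivially; their ranks add up to n, so together they span everything, and
    the identity splits accordingly. *)
Lemma fixed_plus_range : exists X Y : 'M[R]_n,
  X * A = X /\ 1 = X + Y * (1 - A).
Proof.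
pose D : 'M[R]_n := 1 - A; pose K := kermx D.
have KA : (K :&: D)%MS = 0.
  have /submxP[W WD] := capmxSr K D.
  have /submxP[V VK] := capmxSl K D.
  rewrite WD; apply: range_fixed_eq0.
  apply/eqP; rewrite eq_sym -subr_eq0 -[X in X - _]mulr1 -mulrBr.
  rewrite -[W * _]/(W *m D) -WD VK -[_ * _]/(V *m K *m D).
  by rewrite -mulmxA mulmx_ker mulmx0.
have full : row_full (K + D)%MS.
  rewrite /row_full; have := mxrank_sum_cap K D.
  by rewrite KA mxrank0 addn0 => ->; rewrite mxrank_ker subnK// rank_leq_row.
have /sub_addsmxP[[U V] /= UV] := submx_full (1%:M : 'M[R]_n) full.
exists (U *m K), V; split; last exact: UV.
apply/eqP; rewrite eq_sym -subr_eq0 -[X in X - _]mulr1 -mulrBr.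
by rewrite -[_ * _]/(U *m K *m D) -mulmxA mulmx_ker mulmx0.
Qed.

(** Splitting 1 = X + Y (1 - A) as above, the N-th mean is
    X + Y (A - A^(N+1)) / N. *)
Lemma mean_ergodic : exists2 X : 'M[R]_n, X * A = X & cesaro_mean A @ \oo --> X.
Proof.
have [X [Y [XA XY]]] := fixed_plus_range; exists X => //.
have cesE N : (0 < N)%N ->
    cesaro_mean A N = X + N%:R^-1 *: (Y * (A - A ^+ N.+1)).
  move=> N0; rewrite -[LHS]mul1r {1}XY mulrDl; congr (_ + _).
    rewrite scalemx_mulr mulr_sumr; under eq_bigr do rewrite fixed_mul_exp//.
    rewrite big_const_nat subSS subn0 iter_addr addr0.
    rewrite -[X *+ N]scaler_nat scalerA.
    by rewrite mulVf ?scale1r// pnatr_eq0 -lt0n.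
  by rewrite -mulrA scalemx_mulr sum_powers_telescope -scalemx_mulr.
apply: cvg_mx_coord => i j.
have H : (fun N : nat => X i j + N%:R^-1 * (Y * (A - A ^+ N.+1)) i j) @ \oo
    --> X i j + 0.
  apply: cvgD; first exact: cvg_cst.
  apply: (@cvg_over_nat _ (\sum_k `|Y i k| * (B + B))) => N.
  by apply: mulmx_coord_le => k h; exact: (powerB_le 1).
rewrite addr0 in H; apply: cvg_trans H; apply: near_eq_cvg.
near=> N; rewrite cesE ?mxE//.
by near: N; exists 1%N.
Unshelve. all: by end_near. Qed.

End PowerBounded.
End MeanErgodic.

(** * Stochastic matrices *)

Section Stochastic.
Variable R : realType.

Definition stochastic_mx n (Q : 'M[R]_n) : Prop :=
  (forall i j, 0 <= Q i j) /\ (forall i, \sum_j Q i j = 1).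

Lemma stochastic_mxX n (Q : 'M[R]_n) m :
  stochastic_mx Q -> stochastic_mx (Q ^+ m).
Proof.
move=> [Q0 Q1]; elim: m => [|m [IH0 IH1]].
  rewrite expr0; split=> [i j|i]; first by rewrite mxE ler0n.
  rewrite (bigD1 i)//= big1 ?addr0 ?mxE ?eqxx// => j ji.
  by rewrite mxE eq_sym (negbTE ji).
split=> [i j|i].
  by rewrite exprSr mxE sumr_ge0// => k _; rewrite mulr_ge0.
under eq_bigr do rewrite exprSr mxE.
rewrite exchange_big/=; under eq_bigr do rewrite -mulr_sumr Q1 mulr1.
exact: IH1.
Qed.

Lemma stochastic_mx_le1 n (Q : 'M[R]_n) i j : stochastic_mx Q -> `|Q i j| <= 1.
Proof.
move=> [Q0 Q1]; rewrite ger0_norm// -(Q1 i) (bigD1 j)//= lerDl.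
exact: sumr_ge0.
Qed.

(** Mass balance of an absorbing set J: the stationary mass of J is that mass
    itself plus what flows in from outside, so the inflow is zero, and with it
    each of its nonnegative terms. *)
Lemma stationary_transient n (Q : 'M[R]_n) (v : 'I_n -> R) (J : pred 'I_n) :
  stochastic_mx Q -> (forall a, 0 <= v a) ->
  (forall b, v b = \sum_a v a * Q a b) ->
  (forall a b, J a -> ~~ J b -> Q a b = 0) ->
  forall a b, ~~ J a -> J b -> 0 < Q a b -> v a = 0.
Proof.
move=> [Q0 Q1] v0 vQ JQ a b Ja Jb Qab.
have into c : J c -> \sum_(b | J b) Q c b = 1.
  move=> Jc; rewrite -(Q1 c) [RHS](bigID J)/= [X in _ + X]big1 ?addr0//.
  by move=> e Je; rewrite (JQ _ _ Jc Je).
have out : \sum_(c | ~~ J c) v c * (\sum_(b | J b) Q c b) = 0.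
  have : \sum_(b | J b) v b = \sum_c v c * (\sum_(b | J b) Q c b).
    rewrite (eq_bigr _ (fun b _ => vQ b)) exchange_big/=.
    by apply: eq_bigr => c _; rewrite mulr_sumr.
  rewrite [RHS](bigID J)/= [X in _ = X + _](eq_bigr v).
    by rewrite -[LHS]addr0 => /addrI/esym.
  by move=> c Jc; rewrite into ?mulr1.
have /eqP : v a * (\sum_(b | J b) Q a b) = 0.
  by apply: psumr_eq0P out _ Ja => c _; rewrite mulr_ge0// sumr_ge0.
rewrite mulf_eq0 => /orP[/eqP//|].
rewrite (bigD1 b)//= gt_eqF// ltr_wpDr// sumr_ge0//.
Qed.

End Stochastic.

(** * Binary stochastic matrices as functions *)

Section FunctionMatrix.
Variables (R : realType) (n : nat).
Local Notation T := {ffun 'I_n -> 'I_n}.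

Definition fun_mx (f : T) : 'M[R]_n := \matrix_(i, j) (f i == j)%:R.

Lemma fun_mxK f : finfun (fun_of_binmx (fun_mx f)) = f.
Proof.
apply/ffunP => i; rewrite ffunE /fun_of_binmx; case: pickP => [j|/(_ (f i))].
  by rewrite mxE; case: (f i =P j) => // _; rewrite eq_sym oner_eq0.
by rewrite mxE !eqxx.
Qed.

Lemma fun_of_binmxK (F : 'M[R]_n) : binary_stochastic F ->
  fun_mx (finfun (fun_of_binmx F)) = F.
Proof.
move=> [F01 Fex]; apply/matrixP => i j; rewrite mxE ffunE /fun_of_binmx.
have [k [Fk k_uniq]] := Fex i.
case: pickP => [h /eqP Fh /=|/(_ k)]; last by rewrite Fk eqxx.
have [<-|hj] := eqVneq h j; first by rewrite Fh.
have [->//|Fj] := F01 i j.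
by rewrite -(k_uniq _ Fh) -(k_uniq _ Fj) eqxx in hj.
Qed.

Lemma fun_mxM (f g : T) : fun_mx f *m fun_mx g = fun_mx [ffun i => g (f i)].
Proof.
apply/matrixP => i j; rewrite !mxE (bigD1 (f i))//= big1 => [|k kf].
  by rewrite addr0 !mxE eqxx mul1r ffunE.
by rewrite mxE eq_sym (negbTE kf) mul0r.
Qed.

Lemma fun_mx1 : fun_mx [ffun i => i] = 1.
Proof. by apply/matrixP => i j; rewrite !mxE ffunE. Qed.

Lemma subset_fun_mx l (f : T) (a b : 'I_#|lsubset n l|) :
  subset_mx l (fun_mx f) a b =
  (f @: val (enum_val a) == val (enum_val b))%SET%:R.
Proof.
rewrite mxE -[in RHS](fun_mxK f); congr (_ == _)%:R.
by apply: eq_imset => i; rewrite ffunE.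
Qed.

(** The middle subset of the product can only be the image of the first one
    under f.  If that image has fewer than l elements, no l-subset qualifies,
    and both sides vanish since applying g cannot enlarge it again. *)
Lemma subset_mxM l (f g : T) :
  subset_mx l (fun_mx f *m fun_mx g) =
  subset_mx l (fun_mx f) *m subset_mx l (fun_mx g).
Proof.
apply/matrixP => a b; rewrite fun_mxM subset_fun_mx [RHS]mxE.
under eq_bigr do rewrite !subset_fun_mx.
have -> : ([ffun i => g (f i)] @: val (enum_val a) =
           g @: (f @: val (enum_val a)))%SET.
  by rewrite -imset_comp; apply: eq_imset => i; rewrite ffunE.
have [fl|fl] := eqVneq #|(f @: val (enum_val a))%SET| l.
  pose I : lsubset n l := Sub (f @: val (enum_val a))%SET (introT eqP fl).
  rewrite (bigD1 (enum_rank I))//= big1 => [|k kI].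
    by rewrite addr0 enum_rankK eqxx mul1r.
  rewrite (_ : (_ == _) = false) ?mul0r//; apply: contraNF kI => /eqP fk.
  apply/eqP; rewrite -[k]enum_valK; congr enum_rank; apply: val_inj.
  exact: esym fk.
rewrite big1 => [|k _].
  case: eqP => // gf; have := valP (enum_val b); rewrite /= -gf.
  have := leq_imset_card g (f @: val (enum_val a))%SET.
  have := leq_imset_card f (val (enum_val a)).
  rewrite (eqP (valP (enum_val a))) => f_le g_le /eqP g_eq.
  by rewrite g_eq in g_le; rewrite eqn_leq f_le g_le in fl.
case: eqP => [fk|]; last by rewrite mul0r.
by rewrite fk (eqP (valP (enum_val k))) eqxx in fl.
Qed.

Lemma subset_mx1 l : subset_mx l (1 : 'M[R]_n) = 1.
Proof.
rewrite -fun_mx1; apply/matrixP => a b; rewrite subset_fun_mx mxE.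
rewrite (_ : (_ @: _)%SET = val (enum_val a)); last first.
  by rewrite -[RHS]imset_id; apply: eq_imset => i; rewrite ffunE.
by rewrite val_eqE (inj_eq enum_val_inj).
Qed.

End FunctionMatrix.

(** Sums over the semigroup, its kernel and pairs of its elements become sums
    over a finite type of functions. *)
Lemma fsbig_fin_inj (R : Type) (idx : R) (op : Monoid.com_law idx)
    (I : finType) (J : choiceType) (e : I -> J) (D : set J) (F : J -> R) :
  injective e -> D `<=` range e ->
  \big[op/idx]_(x \in D) F x = \big[op/idx]_(i | e i \in D) F (e i).
Proof.
move=> e_inj De.
have DE : D = e @` [set` [pred i | e i \in D]].
  apply/seteqP; split=> [x Dx|_ [i /= + <-]]; last by rewrite !inE.
  by have [i _ ei] := De x Dx; exists i => //=; rewrite !inE ei.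
rewrite {1}DE fsbig_image; last by move=> ? ? _ _; exact: e_inj.
rewrite -(@bigfs _ _ _ _ (index_enum I))// ?index_enum_uniq//.
by move=> i _; rewrite mem_index_enum.
Qed.

Lemma sum_neq0 (V : nmodType) (I : finType) (F : I -> V) :
  \sum_i F i != 0 -> exists i, F i != 0.
Proof.
move=> /eqP F0; apply: contrapT => /forallNP F_eq0; apply: F0.
by apply: big1 => i _; apply/eqP/negPn/negP/F_eq0.
Qed.

(** * The random walk generated by the colors *)

Section ColoringWalk.
Variables (R : realType) (n d : nat) (C : 'I_d -> 'M[R]_n).
Hypotheses (d_gt0 : (0 < d)%N) (C_bin : forall i, binary_stochastic (C i)).

Local Notation state := 'I_#|{ffun 'I_n -> 'I_n}|.
Local Notation S := (gen_semigroup C).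

Definition state_mx (a : state) : 'M[R]_n := fun_mx R (enum_val a).

Definition state_of (F : 'M[R]_n) : state :=
  enum_rank (finfun (fun_of_binmx F)).

Definition id_state : state := enum_rank [ffun i => i].

(** Right multiplication by [C i] is post-composition, since a product of
    binary stochastic matrices applies its left factor first. *)
Definition walk_step (a : state) (i : 'I_d) : state :=
  enum_rank [ffun x => fun_of_binmx (C i) (enum_val a x)].

(** The state space consists of all functions, not only of those in the
    semigroup, so that it contains the identity, where the walk starts. *)
Definition walk_mx : 'M[R]_#|{ffun 'I_n -> 'I_n}| :=
  \matrix_(a, b) (d%:R^-1 * \sum_(i < d) (walk_step a i == b)%:R).

Local Notation E := state_mx.
Local Notation P := walk_mx.

Lemma state_mx_inj : injective E.
Proof.
move=> a b ab; apply: enum_val_inj.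
by rewrite -(fun_mxK R (enum_val a)) [fun_mx _ _]ab fun_mxK.
Qed.

Lemma state_mx_of F : binary_stochastic F -> E (state_of F) = F.
Proof. by move=> ?; rewrite /E enum_rankK fun_of_binmxK. Qed.

Lemma state_mx_id : E id_state = 1.
Proof. by rewrite /E enum_rankK fun_mx1. Qed.

Lemma state_mx_step a i : E (walk_step a i) = E a *m C i.
Proof.
rewrite -[in RHS](fun_of_binmxK (C_bin i)) fun_mxM /E enum_rankK.
by congr fun_mx; apply/ffunP => x; rewrite !ffunE.
Qed.

Lemma sum_walk (V : lmodType R) (F : state -> V) a :
  \sum_b P a b *: F b = d%:R^-1 *: \sum_(i < d) F (walk_step a i).
Proof.
rewrite scaler_sumr.
under eq_bigr do rewrite mxE -scalerA scaler_suml scaler_sumr.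
rewrite exchange_big/=; apply: eq_bigr => i _.
rewrite (bigD1 (walk_step a i))//= eqxx scale1r big1 ?addr0// => b bi.
by rewrite eq_sym (negbTE bi) scale0r scaler0.
Qed.

Lemma walk_stochastic : stochastic_mx P.
Proof.
split=> [a b|a]; first by rewrite mxE mulr_ge0 ?invr_ge0// sumr_ge0.
rewrite (eq_bigr (fun b => P a b *: (1 : R^o))); last first.
  by move=> b _; rewrite -[RHS]/(_ * _) mulr1.
rewrite sum_walk sumr_const card_ord -[LHS]/(_ * _).
by rewrite mulVf// pnatr_eq0 -lt0n.
Qed.

Lemma walk_step_gt0 a i : 0 < P a (walk_step a i).
Proof.
rewrite mxE mulr_gt0 ?invr_gt0 ?ltr0n// (bigD1 i)//= eqxx.
by rewrite ltr_pwDl// sumr_ge0.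
Qed.

Lemma walk_neq0 a b : P a b != 0 -> exists i, b = walk_step a i.
Proof.
rewrite mxE mulf_eq0 negb_or => /andP[_ /sum_neq0[i]].
by case: (walk_step a i =P b) => [<-|]; [exists i|rewrite eqxx].
Qed.

Lemma semigroup_color i : S (C i).
Proof. by apply: sub_gen_smallest; exists i. Qed.

Lemma semigroupM u v : S u -> S v -> S (u *m v).
Proof.
move=> Su Sv M [Mmul CM].
exact: Mmul (Su _ (conj Mmul CM)) (Sv _ (conj Mmul CM)).
Qed.

Lemma semigroup_sub_states : S `<=` range E.
Proof.
apply: smallest_sub => [_ _ [a _ <-] [b _ <-]|_ [i _ <-]].
  by exists (enum_rank [ffun x => enum_val b (enum_val a x)]) => //;
    rewrite /E fun_mxM enum_rankK.
by exists (state_of (C i)) => //; rewrite state_mx_of.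
Qed.

(** If x is a word of length k + 1 in the colors, the walk multiplies its state
    by x with positive probability in k + 1 steps; k does not depend on the
    state, so that one power of the walk serves all states. *)
Lemma walk_reach x : S x ->
  exists k, forall a, exists2 b, E b = E a *m x & 0 < (P ^+ k.+1) a b.
Proof.
apply: (@smallest_sub _ _ _ [set x | exists k, forall a,
  exists2 b, E b = E a *m x & 0 < (P ^+ k.+1) a b]) => /= [u v|_ [i _ <-]].
  move=> [k ku] [h hv]; exists (k + h.+1)%N => a.
  have [b ab Pab] := ku a; have [c bc Pbc] := hv b.
  exists c; first by rewrite bc ab mulmxA.
  rewrite -addSn exprD mxE (bigD1 b)//= ltr_pwDl ?mulr_gt0// sumr_ge0// => e _.
  by have [[P1 _] [P2 _]] := (stochastic_mxX k.+1 walk_stochastic,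
    stochastic_mxX h.+1 walk_stochastic); rewrite mulr_ge0.
exists 0 => a; exists (walk_step a i); first exact: state_mx_step.
by rewrite expr1 walk_step_gt0.
Qed.

(** Converse of [walk_reach]: the walk moves only by elements of the semigroup,
    so it cannot leave an ideal. *)
Lemma walk_factor m a b :
  (P ^+ m.+1) a b != 0 -> exists2 s, S s & E b = E a *m s.
Proof.
elim: m b => [|m IH] b.
  rewrite expr1 => /walk_neq0[i ->]; exists (C i); first exact: semigroup_color.
  exact: state_mx_step.
rewrite exprSr mxE => /sum_neq0[c].
rewrite mulf_eq0 negb_or => /andP[/IH[s Ss cs] /walk_neq0[i ->]].
exists (s *m C i); first exact: semigroupM (semigroup_color i).
by rewrite state_mx_step cs mulmxA.
Qed.

Lemma walk_id_semigroup m a : (P ^+ m.+1) id_state a != 0 -> S (E a).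
Proof. by move=> /walk_factor[s Ss ->]; rewrite state_mx_id mul1mx. Qed.

Lemma color_mu1E a :
  color_mu1 C (E a) = d%:R^-1 * \sum_(i < d) (C i == E a)%:R.
Proof.
rewrite /color_mu1 mulrC -sum1_card natr_sum big_mkcond/=; congr (_ * _).
by apply: eq_bigr => i _; rewrite inE; case: ifP.
Qed.

Lemma walk_mu1 a b :
  P a b = \sum_c (E a *m E c == E b)%:R * color_mu1 C (E c).
Proof.
under eq_bigr do rewrite color_mu1E mulrCA mulr_sumr.
rewrite -mulr_sumr exchange_big/= mxE; congr (_ * _); apply: eq_bigr => i _.
rewrite (bigD1 (state_of (C i)))//= state_mx_of// eqxx mulr1 big1 => [|c ci].
  by rewrite addr0 -state_mx_step (inj_eq state_mx_inj).
rewrite -{1}(state_mx_of (C_bin i)) (inj_eq state_mx_inj).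
by rewrite [_ == c]eq_sym (negbTE ci) mulr0.
Qed.

(** One convolution with the first measure is one step of the walk; the
    membership conditions in [convolution] only discard pairs where one of the
    two factors has measure zero. *)
Lemma color_muE m a : color_mu C m.+1 (E a) = (P ^+ m.+1) id_state a.
Proof.
elim: m a => [|m IH] b.
  rewrite expr1 /color_mu/= walk_mu1 state_mx_id.
  under eq_bigr do rewrite mul1mx (inj_eq state_mx_inj).
  rewrite (bigD1 b)//= eqxx mul1r big1 ?addr0// => c cb.
  by rewrite (negbTE cb) mul0r.
rewrite -[LHS]/(convolution S (color_mu C m.+1) (color_mu1 C) (E b)).
rewrite /convolution.
rewrite (@fsbig_fin_inj _ _ _ (state * state)%type _
  (fun p => (E p.1, E p.2))); first last.
- move=> [u v] [/= /semigroup_sub_states[a _ <-]].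
  by move=> /semigroup_sub_states[c _ <-] _; exists (a, c).
- by move=> [a c] [a' c'] /= [/state_mx_inj -> /state_mx_inj ->].
rewrite exprSr mxE.
under [RHS]eq_bigr do rewrite walk_mu1 mulr_sumr.
rewrite pair_bigA/= big_mkcond/=; apply: eq_bigr => -[a c] _ /=.
rewrite IH; case: ifPn => [/set_mem[_ _ /= ->]|/negP nS].
  by rewrite eqxx mul1r.
have [ac|] := eqVneq (E a *m E c) (E b); last by rewrite mul0r mulr0.
have [->|/walk_id_semigroup Sa] := eqVneq ((P ^+ m.+1) id_state a) 0.
  by rewrite mul0r.
have [->|mu_c] := eqVneq (color_mu1 C (E c)) 0; first by rewrite !mulr0.
exfalso; apply: nS; rewrite inE; split=> //=.
move: mu_c; rewrite color_mu1E mulf_eq0 negb_or => /andP[_ /sum_neq0[i]].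
by case: (C i =P E c) => [<- _|]; [exact: semigroup_color|rewrite eqxx].
Qed.

Lemma subset_mx_state l a i :
  subset_mx l (E a) * subset_mx l (C i) = subset_mx l (E (walk_step a i)).
Proof.
rewrite state_mx_step -(fun_of_binmxK (C_bin i)).
by rewrite subset_mxM.
Qed.

Lemma color_level_exp l m :
  color_level C l ^+ m = \sum_a (P ^+ m) id_state a *: subset_mx l (E a).
Proof.
elim: m => [|m IH].
  rewrite expr0 (bigD1 id_state)//= big1 => [|a ai].
    by rewrite addr0 mxE eqxx scale1r state_mx_id subset_mx1.
  by rewrite mxE eq_sym (negbTE ai) scale0r.
rewrite exprSr IH mulr_suml.
under [RHS]eq_bigr do rewrite exprSr mxE scaler_suml.
rewrite exchange_big/=; apply: eq_bigr => a _.
under [RHS]eq_bigr do rewrite -scalerA.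
rewrite -scaler_sumr sum_walk.
rewrite -[_ * _]/(_ *m _) -scalemxAl mulmx_sumr; congr (_ *: _).
rewrite scaler_sumr; apply: eq_bigr => i _.
by rewrite -scalemxAr -subset_mx_state.
Qed.

Lemma kernel_sub_semigroup : color_kernel C `<=` S.
Proof.
apply: smallest_sub => //; split=> //.
  by exists (C (Ordinal d_gt0)); exact: semigroup_color.
by move=> s x Ss Sx; split; exact: semigroupM.
Qed.

Lemma walk_power_bounded m i j : `|(P ^+ m) i j| <= 1.
Proof. exact/stochastic_mx_le1/stochastic_mxX/walk_stochastic. Qed.

(** * The limit measure and its support *)

Section Limit.
Variable X : 'M[R]_#|{ffun 'I_n -> 'I_n}|.
Hypotheses (XP : X * P = X) (P_X : cesaro_mean P @ \oo --> X).

Lemma cesaro_walk_cvg a b :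
  (fun N => cesaro_mean P N a b) @ \oo --> X a b.
Proof.
apply: (cvg_comp _ (fun M : 'M[R]_#|{ffun 'I_n -> 'I_n}| => M a b) P_X).
exact: coord_continuous.
Qed.

Lemma color_lambdaE a : color_lambda C (E a) = X id_state a.
Proof.
rewrite /color_lambda -[RHS](cvg_lim _ (@cesaro_walk_cvg id_state a))//.
congr (limn _); apply/funext => N; rewrite cesaro_meanE; congr (_ * _).
by apply: eq_big_nat => -[//|m] _; rewrite color_muE.
Qed.

Lemma limit_ge0 a b : 0 <= X a b.
Proof.
rewrite -(cvg_lim _ (@cesaro_walk_cvg a b))//.
apply: limr_ge; first by apply/cvg_ex; exists (X a b); exact: cesaro_walk_cvg.
apply: nearW => N; rewrite cesaro_meanE mulr_ge0 ?invr_ge0// sumr_ge0// => m _.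
by have [] := stochastic_mxX m walk_stochastic.
Qed.

Lemma limit_semigroup a : X id_state a != 0 -> S (E a).
Proof.
move=> Xa; apply: contrapT => Sa; move/eqP: Xa; apply.
rewrite -(cvg_lim _ (@cesaro_walk_cvg id_state a))//.
rewrite (_ : (fun N => _) = cst 0) ?lim_cst//.
apply/funext => N; rewrite cesaro_meanE big_nat big1 ?mulr0// => -[//|m] _.
by apply/eqP/negPn/negP => /walk_id_semigroup.
Qed.

(** For an ideal I containing x, the states in I absorb the walk, and from s in
    the semigroup they are reached through s x; a state outside I with positive
    limit mass would contradict [stationary_transient] for the power of the walk
    that reaches s x. *)
Lemma limit_kernel a : X id_state a != 0 -> color_kernel C (E a).
Proof.
move=> Xa I [idI _]; have [[x Ix] IS SI] := idI.
apply: contrapT => Ia; move/eqP: Xa; apply.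
have [->//|Xa] := eqVneq (X id_state a) 0.
have [k kx] := walk_reach (IS _ Ix); have [b abx Pab] := kx a.
apply: (@stationary_transient _ _ (P ^+ k.+1) (X id_state)
    (fun c => `[< I (E c) >]) _ _ _ _ a b) => //.
- exact: stochastic_mxX walk_stochastic.
- exact: limit_ge0.
- by move=> c; rewrite -{1}(fixed_mul_exp k.+1 XP) mxE.
- move=> c e /asboolP Ic; apply: contraNeq => /walk_factor[s Ss ->].
  by apply/asboolP; have [] := SI _ _ Ss Ic.
- by apply/asboolP.
- apply/asboolP; rewrite abx.
  by have [] := SI _ _ (limit_semigroup Xa) Ix.
Qed.

Lemma color_OmegaE l :
  color_Omega C l = \sum_a X id_state a *: subset_mx l (E a).
Proof.
rewrite /color_Omega (fsbig_fin_inj _ _ state_mx_inj); last first.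
  exact: subset_trans kernel_sub_semigroup semigroup_sub_states.
rewrite big_mkcond/=; apply: eq_bigr => a _; rewrite color_lambdaE.
case: ifPn => // /negP; rewrite inE => Ka.
have [->|/limit_kernel//] := eqVneq (X id_state a) 0.
by rewrite scale0r.
Qed.

Lemma cesaro_level_cvg l :
  cesaro_mean (color_level C l) @ \oo --> color_Omega C l.
Proof.
rewrite color_OmegaE.
have -> : cesaro_mean (color_level C l) =
    (fun N => \sum_a cesaro_mean P N id_state a *: subset_mx l (E a)).
  apply/funext => N; rewrite /cesaro_mean.
  under eq_bigr do rewrite color_level_exp.
  rewrite exchange_big/= scaler_sumr; apply: eq_bigr => a _.
  by rewrite -scaler_suml scalerA -/(cesaro_mean P N) cesaro_meanE.
apply: cvg_big => [|a _]; first exact: add_continuous.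
apply: cvgZr_tmp; exact: cesaro_walk_cvg.
Qed.
End Limit.
End ColoringWalk.

Theorem mainTheorem9 (R : realType) (n d : nat) (adj : 'M[nat]_n)
    (C : 'I_d -> 'M[R]_n)
    (d_gt0 : (0 < d)%N)
    (adj_out : out_regular d adj)
    (C_bin : forall i, binary_stochastic (C i))
    (adj_C : map_mx (fun k : nat => k%:R) adj = \sum_(i < d) C i)
    (A_irr : irreducible_mx (d%:R^-1 *: map_mx (fun k : nat => k%:R : R) adj))
    (A_aper : aperiodic_mx (d%:R^-1 *: map_mx (fun k : nat => k%:R : R) adj))
    (l : nat) (l_bounds : (1 <= l <= n)%N) :
  (fun N : nat => N%:R^-1 *: \sum_(1 <= m < N.+1) color_level C l ^+ m) @ \oo
    --> color_Omega C l.
Proof.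
have [X XP P_X] := mean_ergodic (@walk_power_bounded _ _ _ C d_gt0).
exact: (cesaro_level_cvg d_gt0 C_bin XP P_X).
Qed.
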